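(* For each integer $n \geq 2$ there is a family $\mathcal{F}_n$ of open subsets of the Euclidean space $\mathbb{R}^n$ such that $\mathcal{F}_n$ has cardinality $c$ and, whenever $U, V \in \mathcal{F}_n$ and $U \neq V$, neither $U, V$ nor $\overline{U}, \overline{V}$ are homeomorphic subspaces of $\mathbb{R}^n$. Moreover: (a) the family $\mathcal{F}_n$ can be chosen so that for every $X \in \mathcal{F}_n$ the set $\overline{X}$ is compact and is a union of closed cubes of the form $[a_1, a_1+h] \times \cdots \times [a_n, a_n+h]$ with $h > 0$ (where $h$ may depend on the cube) such that the interiors of distinct cubes are always disjoint; (b) alternatively, the family $\mathcal{F}_n$ can be chosen so that for every $X \in \mathcal{F}_n$ the set $\overline{X}$ is a union of unit cubes of the form $[k_1, k_1+1] \times \cdots \times [k_n, k_n+1]$ with $k_1, \ldots, k_n \in \mathbb{Z}$.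
   Context: $c$ denotes the cardinality of $\mathbb{R}$. $\overline{X}$ denotes the closure of $X$ in $\mathbb{R}^n$. ''Neither $U,V$ nor $\overline U,\overline V$ are homeomorphic'' means that $U$ is not homeomorphic to $V$ and $\overline{U}$ is not homeomorphic to $\overline{V}$. *)

(* Defs.v *)
From HB Require Import structures.
From mathcomp Require Import all_boot all_order all_algebra.
From mathcomp Require Import all_classical all_reals all_analysis.
Set Implicit Arguments.
Unset Strict Implicit.
Unset Printing Implicit Defensive.
Import Order.TTheory GRing.Theory Num.Theory numFieldNormedType.Exports.
Local Open Scope classical_set_scope.
Local Open Scope ring_scope.

Definition homeomorphic (X Y : topologicalType) : Prop :=
  exists (f : X -> Y) (g : Y -> X),
    [/\ cancel f g, cancel g f, continuous f & continuous g].

(* Subsets are compared through their types of points [set_type A], which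
   carry the initial topology of the inclusion, i.e. the subspace topology.
   (The library's [subspace A] would not do: its points are all those of the
   ambient space.) *)
Definition homeomorphic_sets (T : topologicalType) (A B : set T) : Prop :=
  homeomorphic (set_type A) (set_type B).

(* The norm on ['rV[R]_n] is the sup norm; it induces the usual Euclidean
   topology, and only the topology is used here. *)
Definition nonhomeomorphic_family (R : realType) (n : nat)
    (F : set (set 'rV[R]_n)) : Prop :=
  [/\ forall U, F U -> open U,
      (F #= [set: R])%card &
      forall U V, F U -> F V -> U <> V ->
        ~ homeomorphic_sets U V /\ ~ homeomorphic_sets (closure U) (closure V)].

Definition closed_cube (R : realType) (n : nat) (a : 'rV[R]_n) (h : R) :
    set 'rV[R]_n :=
  [set x | forall i : 'I_n, a ord0 i <= x ord0 i <= a ord0 i + h].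

Definition is_cube (R : realType) (n : nat) (Q : set 'rV[R]_n) : Prop :=
  exists (a : 'rV[R]_n) (h : R), 0 < h /\ Q = closed_cube a h.

Definition is_unit_lattice_cube (R : realType) (n : nat)
    (Q : set 'rV[R]_n) : Prop :=
  exists k : 'rV[int]_n, Q = closed_cube (map_mx intr k) 1.

Definition union_of_nonoverlapping_cubes (R : realType) (n : nat)
    (A : set 'rV[R]_n) : Prop :=
  exists C : set (set 'rV[R]_n),
    [/\ forall Q, C Q -> is_cube Q,
        forall Q Q', C Q -> C Q' -> Q <> Q' -> interior Q `&` interior Q' = set0 &
        A = \bigcup_(Q in C) Q].

Definition union_of_unit_lattice_cubes (R : realType) (n : nat)
    (A : set 'rV[R]_n) : Prop :=
  exists C : set (set 'rV[R]_n),
    (forall Q, C Q -> is_unit_lattice_cube Q) /\ A = \bigcup_(Q in C) Q.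

(* Main.v *)
Require Import Defs.
From HB Require Import structures.
From mathcomp Require Import all_boot all_order all_algebra.
From mathcomp Require Import all_classical all_reals all_analysis.
From mathcomp Require Import ring lra zify.
Import Order.TTheory GRing.Theory Num.Theory numFieldNormedType.Exports.
Set Implicit Arguments.
Unset Strict Implicit.
Unset Printing Implicit Defensive.
Local Open Scope classical_set_scope.
Local Open Scope ring_scope.

(* For A a set of naturals, the closed set is a base cube together with, for
   each k in A, a block of k + 2 equal cubes placed along the diagonal, touching
   consecutively at corners. The open set is made of the interiors of all these
   cubes, those of block k being punctured at k + 1 points of the diagonal.
   The clopen connected pieces of the closed set are the blocks, and possibly
   the base cube; block k has exactly k + 1 cut points, since in dimension at
   least 2 a cube minus a point is connected. Those of the open set are the
   punctured cubes; a cube with k + 1 punctures has exactly k + 2 ends. Hence A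
   is determined by either homeomorphism type. Placing blocks of unit cubes to
   infinity gives (b); letting blocks of cubes of decreasing size converge to a
   corner of the base cube, which contains the limit point, gives (a). *)

(** * Cut points, ends and clopen pieces *)

Section Homeomorphism_invariants.
Context {T : topologicalType}.
Implicit Types (A B D K : set T) (f g : T -> T).

(** Total maps of the ambient space, constrained only on [A] and [B]: restricting a homeomorphism to
    a subset then changes no type. *)
Definition homeo_pair A B f g : Prop :=
  [/\ {within A, continuous f}, {within B, continuous g},
      forall x, A x -> B (f x) /\ g (f x) = x &
      forall x, B x -> A (g x) /\ f (g x) = x].

Lemma homeo_pair_sym A B f g : homeo_pair A B f g -> homeo_pair B A g f.
Proof. by case. Qed.

Lemma homeo_pair_image A B f g : homeo_pair A B f g -> f @` A = B.
Proof.
move=> [_ _ AB BA]; apply/seteqP; split => [_ [x Ax <-]|y By].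
  by have [] := AB x Ax.
by have [Ag fg] := BA y By; exists (g y).
Qed.

Lemma homeo_pair_sub A B f g D : homeo_pair A B f g -> D `<=` A ->
  homeo_pair D (f @` D) f g.
Proof.
move=> [cf cg AB BA] DA; split.
- exact: continuous_subspaceW cf.
- by apply: continuous_subspaceW cg => _ [x /DA Ax <-]; have [] := AB x Ax.
- by move=> x Dx; split; [exists x|have [] := AB x (DA x Dx)].
- by move=> _ [x Dx <-]; have [_ ->] := AB x (DA x Dx).
Qed.

Lemma homeo_pair_connected A B f g : homeo_pair A B f g ->
  connected A -> connected B.
Proof.
move=> h cA; rewrite -(homeo_pair_image h).
by case: h => cf _ _ _; exact: connected_continuous_connected.
Qed.

Lemma homeo_pair_compact A B f g : homeo_pair A B f g ->
  compact A -> compact B.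
Proof.
move=> h cA; rewrite -(homeo_pair_image h).
by case: h => cf _ _ _; exact: continuous_compact.
Qed.

Definition rel_open A D : Prop := exists2 W, open W & D = A `&` W.
Definition rel_closed A D : Prop := exists2 W, closed W & D = A `&` W.

(** Within [B], the image under [f] is the preimage under [g], so continuity of [g] suffices. *)
Lemma homeo_pair_rel_open A B f g D : homeo_pair A B f g ->
  rel_open A D -> rel_open B (f @` D).
Proof.
move=> [_ /continuousP cg AB BA] [W oW ->].
have /open_subspaceP[W' oW' W'E] := cg _ oW.
exists W' => //; rewrite [RHS]setIC W'E; apply/seteqP; split => [_ [x [Ax Wx] <-]|].
  by have [Bf gf] := AB x Ax; split => //=; rewrite /preimage/= /from_subspace gf.
by move=> y [Wy By]; have [Ag fg] := BA y By; exists (g y).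
Qed.

Lemma homeo_pair_rel_closed A B f g D : homeo_pair A B f g ->
  rel_closed A D -> rel_closed B (f @` D).
Proof.
move=> [_ /continuous_closedP cg AB BA] [W oW ->].
have /closed_subspaceP[W' oW' W'E] := cg _ oW.
exists W' => //; rewrite [RHS]setIC W'E; apply/seteqP; split => [_ [x [Ax Wx] <-]|].
  by have [Bf gf] := AB x Ax; split => //=; rewrite /preimage/= /from_subspace gf.
by move=> y [Wy By]; have [Ag fg] := BA y By; exists (g y).
Qed.

Definition homeo_invariant (P : set T -> Prop) : Prop :=
  forall A B f g, homeo_pair A B f g -> P A -> P B.

Definition has_clopen_piece (P : set T -> Prop) A : Prop :=
  exists D, [/\ rel_open A D, rel_closed A D, D !=set0, connected D & P D].

Lemma has_clopen_piece_invariant P :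
  homeo_invariant P -> homeo_invariant (has_clopen_piece P).
Proof.
move=> iP A B f g h [D [oD cD [x Dx] conD PD]].
have hD : homeo_pair D (f @` D) f g.
  by apply: homeo_pair_sub h _; case: oD => W _ ->; exact: subIsetl.
exists (f @` D); split.
- exact: homeo_pair_rel_open h oD.
- exact: homeo_pair_rel_closed h cD.
- by exists (f x); apply: imageP.
- exact: homeo_pair_connected hD conD.
- exact: iP hD PD.
Qed.

Definition has_cut_points (m : nat) A : Prop :=
  ([set p | A p /\ ~ connected (A `\ p)] #= `I_m)%card.

Lemma homeo_pair_cut A B f g p : homeo_pair A B f g -> A p ->
  connected (A `\ p) -> connected (B `\ f p).
Proof.
move=> h Ap; have h' : homeo_pair (A `\ p) (f @` (A `\ p)) f g.
  by apply: homeo_pair_sub h _; exact: subDsetl.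
suff -> : B `\ f p = f @` (A `\ p) by exact: homeo_pair_connected h'.
case: h => _ _ AB BA; apply/seteqP; split => [y [By nyp]|_ [x [Ax nxp] <-]].
  have [Ag fg] := BA y By; exists (g y) => //; split => // gyp.
  by apply: nyp; rewrite /= -gyp fg.
have [Bf gf] := AB x Ax; split => //= fxp; apply: nxp => /=.
by rewrite -gf fxp; have [] := AB p Ap.
Qed.

Lemma has_cut_points_invariant m : homeo_invariant (has_cut_points m).
Proof.
move=> A B f g h; rewrite /has_cut_points => cA.
suff -> : [set p | B p /\ ~ connected (B `\ p)] =
          f @` [set p | A p /\ ~ connected (A `\ p)].
  apply: card_eq_trans cA; apply: inj_card_eq => x y.
  rewrite !inE => -[Ax _] [Ay _] fxy; case: h => _ _ AB _.
  by have [_ <-] := AB x Ax; have [_ <-] := AB y Ay; rewrite fxy.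
apply/seteqP; split => [y [By ncy]|_ [x [Ax ncx] <-]].
  have [_ _ _ /(_ y By)[Ag fg]] := h; exists (g y) => //; split => // cgy.
  by apply: ncy; rewrite -fg; exact: homeo_pair_cut h Ag cgy.
have [_ _ /(_ x Ax)[Bf gf] _] := h; split => // cfx; apply: ncx.
by rewrite -gf; exact: homeo_pair_cut (homeo_pair_sym h) Bf cfx.
Qed.

(** A lower bound on the number of ends in the sense of Freudenthal: the [V i] are disjoint
    neighbourhoods of infinity in [A]. With [K'] empty, the last clause makes every [V i]
    nonempty. *)
Definition ends_at_least (m : nat) A : Prop :=
  exists K (V : 'I_m -> set T),
    [/\ K `<=` A /\ compact K,
        forall i, rel_open A (V i),
        trivIset setT V,
        A `\` K = \bigcup_i V i &
        forall i K', compact K' -> K' `<=` A -> ~ V i `<=` K'].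

Lemma ends_at_least_invariant m : homeo_invariant (ends_at_least m).
Proof.
move=> A B f g h [K [V [[KA cK] oV tV AKV nV]]].
have VA i : V i `<=` A by case: (oV i) => W _ ->; exact: subIsetl.
have [_ _ AB BA] := h.
have fI x y : A x -> A y -> f x = f y -> x = y.
  by move=> /AB[_ {2}<-] /AB[_ {2}<-] ->.
exists (f @` K), (fun i => f @` V i); split.
- split; last exact: homeo_pair_compact (homeo_pair_sub h KA) cK.
  by move=> _ [x /KA/AB[Bf _] <-].
- by move=> i; exact: homeo_pair_rel_open h (oV i).
- apply/trivIsetP => i j _ _ ij; rewrite -subset0 => _ [[x Vx <-] [y Vy fxy]].
  have yx := fI y x (VA _ _ Vy) (VA _ _ Vx) fxy.
  move: Vy; rewrite yx => Vjx.
  have : (V i `&` V j) x by [].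
  by have /trivIsetP -> := tV.
- rewrite -image_bigcup -AKV; apply/seteqP; split => [y [By nK]|].
    have [Ag fg] := BA y By; exists (g y) => //; split => // Kg.
    by apply: nK; rewrite -fg; exact: imageP.
  move=> _ [x [Ax nKx] <-]; split; first by have [] := AB x Ax.
  by move=> [z Kz fzx]; apply: nKx; rewrite -(fI z x)//; exact: KA.
- move=> i K' cK' K'B VK'; apply: (nV i (g @` K')).
  + exact: homeo_pair_compact (homeo_pair_sub (homeo_pair_sym h) K'B) cK'.
  + by move=> _ [y /K'B/BA[Ag _] <-].
  + move=> x Vx; exists (f x); first by apply: VK'; exact: imageP.
    by have [] := AB x (VA i x Vx).
Qed.

Definition has_ends (m : nat) A : Prop :=
  ends_at_least m A /\ forall m', (m < m')%N -> ~ ends_at_least m' A.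

Lemma has_ends_invariant m : homeo_invariant (has_ends m).
Proof.
move=> A B f g h [e ne]; split; first exact: ends_at_least_invariant h e.
move=> m' /ne nm' e'; apply: nm'.
exact: ends_at_least_invariant (homeo_pair_sym h) e'.
Qed.

End Homeomorphism_invariants.

(** The maps between types of points are extended to [T] by the default value [point] off the set;
    this is where [T] has to be pointed. *)
Lemma homeomorphic_homeo_pair (T : ptopologicalType) (A B : set T) :
  homeomorphic_sets A B -> exists f g : T -> T, homeo_pair A B f g.
Proof.
move=> [f [g [fK gK cf cg]]].
have valLE (X : set T) (u : set_type X -> T) (z : set_type X) :
    valL u (set_val z) = u z.
  by have /funeqP/(_ z) := @valLK _ _ (point : T) X u.
have valP (X : set T) (z : set_type X) : X (set_val z).
  exact: set_valP.
have valS (X : set T) x : X x -> exists z : set_type X, x = set_val z.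
  by move=> Xx; exists (SigSub (mem_set Xx)).
have cv (X : set T) : continuous (set_val : set_type X -> T).
  exact: initial_continuous.
exists (valL (set_val \o f)), (valL (set_val \o g)); split.
- apply/subspace_valL_continuousP => x.
  by apply: continuous_comp; [exact: cf|exact: cv].
- apply/subspace_valL_continuousP => x.
  by apply: continuous_comp; [exact: cg|exact: cv].
- by move=> _ /valS[z ->]; rewrite !valLE/= fK; split => //; exact: valP.
- by move=> _ /valS[z ->]; rewrite !valLE/= gK; split => //; exact: valP.
Qed.

(** * Connectedness of boxes *)

Section Connected_boxes.
Context {R : realType}.

Lemma connected_by_pairs (T : topologicalType) (A : set T) :
  (forall x y, A x -> A y ->
    exists S, [/\ S `<=` A, connected S, S x & S y]) ->
  connected A.
Proof.
move=> h; have [[x Ax]|nA] := pselect (A !=set0); last first.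
  suff -> : A = set0 by exact: connected0.
  by rewrite -subset0 => x Ax; apply: nA; exists x.
suff <- : connected_component A x = A by exact: component_connected.
apply/seteqP; split; first exact: connected_component_sub.
by move=> y Ay; have [S [SA cS Sx Sy]] := h x y Ax Ay; exists S.
Qed.

Lemma convex_connected (V : normedModType R) (A : set V) :
  (forall x y t, A x -> A y -> 0 <= t <= 1 -> A (x + t *: (y - x))) ->
  connected A.
Proof.
move=> cA; apply: connected_by_pairs => x y Ax Ay.
exists ((fun t : R => x + t *: (y - x)) @` `[0, 1]%classic); split.
- by move=> _ [t /= t01 <-]; apply: cA => //; rewrite in_itv /= in t01.
- apply: connected_continuous_connected; first exact: segment_connected.
  apply: continuous_subspaceT => t.
  by apply: cvgD; [exact: cvg_cst|apply: cvgZr_tmp; exact: cvg_id].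
- by exists 0; rewrite /= ?in_itv /= ?lexx ?ler01// scale0r addr0.
- by exists 1; rewrite /= ?in_itv /= ?lexx ?ler01// scale1r addrC subrK.
Qed.

Definition box m (I : 'I_m -> set R) : set 'rV[R]_m :=
  [set x | forall i, I i (x ord0 i)].

Lemma box_connected m (I : 'I_m -> set R) :
  (forall i, is_interval (I i)) -> connected (box I).
Proof.
move=> itI; apply: convex_connected => x y t bx yb /andP[t0 t1] i.
rewrite !mxE; have [xy|/ltW yx] := leP (x ord0 i) (y ord0 i).
  by apply: (itI i _ _ (bx i) (yb i)); nra.
by apply: (itI i _ _ (yb i) (bx i)); nra.
Qed.

(** For [r = 0] this is the box minus the point [c]; for [r > 0], the box minus a closed sup-norm
    ball around [c]. *)
Definition outer_box m (I : 'I_m -> set R) (c : 'rV[R]_m) (r : R) :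
    set 'rV[R]_m :=
  [set x | box I x /\ exists i, r < `|x ord0 i - c ord0 i|].

(** The set is covered by the boxes [H i s] where coordinate [i] is more than [r] away from [c] on
    the side [s] ([true] for below). Nonempty ones in different directions meet. Those in the same
    direction are linked through one in another direction, which exists in dimension at least 2 and
    is nonempty by [far]. *)
Lemma outer_box_connected m (I : 'I_m.+2 -> set R) (c : 'rV[R]_m.+2) (r : R) :
  (forall i, is_interval (I i)) ->
  (forall i, exists2 t, I i t & r < `|t - c ord0 i|) ->
  connected (outer_box I c r).
Proof.
move=> itI far.
pose H i (s : bool) := box (fun j => [set t | I j t /\
  (j = i -> r < (-1) ^+ s * (t - c ord0 i))]).
have HE x : outer_box I c r x <-> exists i s, H i s x.
  split=> [[bx [i ri]]|[i [s Hx]]].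
    exists i, (x ord0 i < c ord0 i) => j; split=> // ->.
    case: (ltP (x ord0 i)) ri => xc.
      by rewrite ltr0_norm ?subr_lt0 //= mulN1r.
    by rewrite ger0_norm ?subr_ge0 //= mul1r.
  split; first by move=> j; have [] := Hx j.
  exists i; have [_ /(_ erefl)/lt_le_trans] := Hx i; apply.
  by apply: le_trans (ler_norm _) _; rewrite normrM normr_sign mul1r.
have cH i s : connected (H i s).
  apply: box_connected => j x y [Ix rx] [Iy ry] z xzy.
  split; first exact: itI xzy.
  move=> ji; move: (rx ji) (ry ji); move: xzy => /andP[xz zy].
  by case: s {rx ry} => /=; rewrite ?expr1 ?expr0; nra.
have HU i s j t : i != j -> H i s !=set0 -> H j t !=set0 ->
    H i s `&` H j t !=set0.
  move=> ij [x Hx] [y Hy].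
  (* Changing coordinate [j] of [x] leaves the condition on coordinate [i] intact. *)
  exists (\row_k if k == j then y ord0 j else x ord0 k); split=> k.
    rewrite mxE; case: eqP => [->|_]; last exact: Hx.
    by split; [have [] := Hy j|move=> ji; rewrite ji eqxx in ij].
  rewrite mxE; case: eqP => [->|kj]; first exact: Hy.
  by split; [have [] := Hx k|].
have Hsub i s : H i s `<=` outer_box I c r by move=> x Hx; apply/HE; exists i, s.
apply: connected_by_pairs => x y /HE[i [s Hx]] /HE[j [t Hy]].
have [ij|] := eqVneq i j; last first.
  move=> ij; exists (H i s `|` H j t); split; [|apply: connectedU => //|by left|by right].
    by rewrite subUset; split; exact: Hsub.
  by apply: HU => //; [exists x|exists y].
have [k ki] : exists k, k != i.
  exists (if i == ord0 then ord_max else ord0).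
  by case: (eqVneq i ord0) => [->|]; rewrite // eq_sym.
have [u Hk] : exists u, H k u !=set0.
  have [v Iv rv] := far k.
  pose z : 'rV_m.+2 := \row_l if l == k then v else x ord0 l.
  have bz : box I z.
    by move=> l; rewrite mxE; case: eqP => [->//|_]; have [] := Hx l.
  exists (v < c ord0 k), z => l; split=> // ->.
  rewrite mxE eqxx; case: (ltP v) rv => xc.
    by rewrite ltr0_norm ?subr_lt0 //= mulN1r.
  by rewrite ger0_norm ?subr_ge0 //= mul1r.
have ne : H j t !=set0 by exists y.
have ne' : H i s !=set0 by exists x.
exists (H i s `|` (H k u `|` H j t)); split.
- by rewrite !subUset; split; [|split]; exact: Hsub.
- apply: connectedU => //.
    have [z [z1 z2]] : H i s `&` H k u !=set0 by apply: HU; rewrite // eq_sym.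
    by exists z; split => //; left.
  by apply: connectedU => //; apply: HU; rewrite // -ij.
- by left.
- by right; right.
Qed.

End Connected_boxes.

(** * Counting ends *)

Section Ends.
Context {R : realType} {T : topologicalType}.

(** A piece that [N] meets is open in [N], and also closed in [N], since the other pieces make up
    its complement there. *)
Lemma connected_sub_piece (J : choiceType) (W N : set T) (V : J -> set T) :
  N `<=` W -> connected N -> N !=set0 -> (forall i, rel_open W (V i)) ->
  trivIset setT V -> N `<=` \bigcup_i V i -> exists i, N `<=` V i.
Proof.
move=> NW cN [x Nx] oV tV NV; have [i _ Vix] := NV x Nx; exists i.
pose B k := sval (cid2 (oV k)).
have oB k : open (B k) by rewrite /B; case: cid2.
have VB k : V k = W `&` B k by rewrite /B; case: cid2.
suff <- : N `&` V i = N by exact: subIsetr.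
apply: cN; first by exists x.
- exists (B i) => //; rewrite VB; apply/seteqP; split => y; first by move=> [? []].
  by move=> [Ny Wy]; split => //; split => //; exact: NW.
- exists (~` \bigcup_(k in [set k | k != i]) B k).
    by apply: open_closedC; apply: bigcup_open.
  apply/seteqP; split => y [Ny Vy]; split => //.
    move=> [k /= ki By]; move/trivIsetP: tV => /(_ k i I I ki).
    rewrite -subset0 => /(_ y); apply; split => //.
    by rewrite VB; split => //; exact: NW.
  have [k _ Vky] := NV y Ny; have [<-//|ki] := eqVneq k i.
  by case: Vy; exists k => //; move: Vky; rewrite VB => -[].
Qed.

(** The image of [K] is closed and misses 0, hence a whole neighbourhood of 0; this covers an empty
    [K] as well. The cap [e0] keeps [e] in the range where neighbourhoods of ends are known to be
    connected. *)
Lemma compact_bounded_below (f : T -> R) (K : set T) (e0 : R) :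
  continuous f -> compact K -> 0 < e0 -> (forall x, K x -> 0 < f x) ->
  exists e, 0 < e <= e0 /\ forall x, K x -> e <= f x.
Proof.
move=> cf cK e0_gt0 f0.
have cfK : closed (f @` K).
  apply: compact_closed; first exact: Rhausdorff.
  by apply: continuous_compact => //; exact: continuous_subspaceT.
have : nbhs (0 : R) (~` (f @` K)).
  apply: open_nbhs_nbhs; split; first exact: closed_openC.
  by move=> [x /f0 + fx0]; rewrite fx0 ltxx.
move=> /nbhs_ballP[e /= egt0 eK]; exists (Num.min e e0); split.
  by rewrite lt_min egt0 e0_gt0 ge_min lexx orbT.
move=> x Kx; rewrite ge_min; apply/orP; left; rewrite leNgt; apply/negP => fxe.
apply: (eK (f x)); last by exists x.
by rewrite /ball /= sub0r normrN gtr0_norm // f0.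
Qed.

(* [f j] vanishes exactly along the [j]-th end, so that [f j < e] defines a
   neighbourhood of that end. *)
Lemma has_ends_positivity (m : nat) (f : 'I_m -> T -> R) (e0 : R) :
  let W := [set x | forall j, 0 < f j x] in
  let N j e := W `&` [set x | f j x < e] in
  (forall j, continuous (f j)) -> 0 < e0 ->
  (forall j e, 0 < e -> e <= e0 -> connected (N j e)) ->
  (forall j e, 0 < e -> N j e !=set0) ->
  (forall e : 'I_m -> R, (forall j, 0 < e j) ->
     compact [set x | forall j, e j <= f j x]) ->
  trivIset setT (fun j => N j e0) ->
  has_ends m W.
Proof.
move=> W N cf e0_gt0 cN ne cK tN; split.
  exists [set x | forall j, e0 <= f j x], (fun j => N j e0); split => //.
  - split; last exact: (cK (fun=> e0)).
    by move=> x h j; exact: lt_le_trans (h j).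
  - move=> i; exists [set x | f i x < e0] => //.
    by apply: (@open_comp _ _ (f i) [set y | y < e0]) => //; exact: open_lt.
  - apply/seteqP; split => [x [Wx /existsNP[j]]|x [j _ [Wx /= fe]]].
      by move/negP; rewrite -ltNge => fe; exists j.
    by split => // /(_ j); rewrite leNgt fe.
  (* On a compact subset of [W], [f i] is bounded away from 0, but it takes arbitrarily small values
     on [N i e0]. *)
  - move=> i K' cK' K'W NK'.
    have [e [/andP[e_gt0 ee0] eK]] :=
      compact_bounded_below (cf i) cK' e0_gt0 (fun x Kx => K'W x Kx i).
    have [x [Wx fx]] := ne i e e_gt0.
    have /NK'/eK : N i e0 x by split => //; exact: lt_le_trans fx ee0.
    by rewrite leNgt fx.
(* Upper bound by pigeonhole: small connected neighbourhoods of the [m] ends avoid [K], so each lies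
   in a single [V i]. As [m < m'], some [V i] contains none of them; it then lies where every [f j]
   is at least [e j], a compact set. *)
move=> m' mm' [K [V [[KW cptK] oV tV WKV nV]]].
have /choice[e eP] j := compact_bounded_below (cf j) cptK e0_gt0
  (fun x Kx => KW x Kx j).
have /choice[phi phiP] : forall j, exists i, N j (e j) `<=` V i.
  move=> j; have [/andP[ej0 eje0] ejK] := eP j.
  apply: (@connected_sub_piece _ W) => //; [|exact: cN|exact: ne|].
    by move=> x [].
  rewrite -WKV => x [Wx /= fx]; split => // /ejK.
  by rewrite leNgt fx.
have [i iphi] : exists i, forall j, phi j != i.
  apply: contrapT => /forallNP h.
  have : (#|'I_m'| <= #|codom phi|)%N.
    rewrite -cardsT subset_leq_card //; apply/fintype.subsetP => i _.
    apply/codomP; have /existsNP[j /negP/negPn/eqP <-] := h i.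
    by exists j.
  by move/leq_trans/(_ (leq_image_card _ _)); rewrite !card_ord leqNgt mm'.
apply: (nV i [set x | forall j, e j <= f j x]).
- by apply: cK => j; have [/andP[]] := eP j.
- move=> x h j; apply: lt_le_trans (h j).
  by have [/andP[]] := eP j.
- move=> x Vx j; rewrite leNgt; apply/negP => fx.
  have Wx : W x by case: (oV i) Vx => B _ -> [].
  move/trivIsetP : tV => /(_ (phi j) i I I (iphi j)).
  rewrite -subset0 => /(_ x); apply; split => //.
  by apply: phiP; split.
Qed.

End Ends.

(** * Punctured cubes *)

Section Punctured_cubes.
Context {R : realType} {n : nat}.
Notation V := 'rV[R]_n.+2.
Implicit Types (x : V) (a d c r : R) (s : nat).

Definition diag (t : R) : V := const_mx t.

Lemma rV_norm_lt x r : `|x| < r <-> forall i, `|x ord0 i| < r.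
Proof.
rewrite [`|x|]mx_normrE; split=> [/bigmax_ltP[_ h] i|h]; first exact: (h (ord0, i)).
apply/bigmax_ltP; split; first exact: le_lt_trans (h ord0).
by move=> [i j] _ /=; rewrite ord1.
Qed.

Lemma rV_norm_le x r : `|x| <= r <-> forall i, `|x ord0 i| <= r.
Proof.
rewrite [`|x|]mx_normrE; split=> [/bigmax_leP[_ h] i|h]; first exact: (h (ord0, i)).
apply/bigmax_leP; split; first exact: le_trans (h ord0).
by move=> [i j] _ /=; rewrite ord1.
Qed.

Lemma rV_norm_gt x r : r < `|x| <-> exists i, r < `|x ord0 i|.
Proof.
split=> [rx|[i]]; last first.
  by move=> /lt_le_trans; apply; have [/(_ (lexx _))] := rV_norm_le x `|x|.
apply: contrapT => /forallNP h; move: rx; apply/negP; rewrite -leNgt.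
by apply/rV_norm_le => i; rewrite leNgt; apply/negP.
Qed.

Definition open_cube a r : set V := [set x | forall i, a < x ord0 i < a + r].

(** The diagonal is divided into [s + 1] steps and the [s] inner division points are removed: in the
    sup norm, punctures are at least [d] from one another and from the boundary. *)
Definition punctured_cube a d s : set V :=
  [set x | open_cube a (d * s.+1%:R) x /\
    forall j, (j < s)%N -> x <> diag (a + d * j.+1%:R)].

(* Distance to the [k]-th puncture, or to the boundary of the cube for [k = 0]
   (as the norm is the sup norm). *)
Definition cube_end a d s (k : 'I_s.+1) x : R :=
  if unlift ord0 k is Some j then `|x - diag (a + d * j.+1%:R)|
  else d * s.+1%:R / 2 - `|x - diag (a + d * s.+1%:R / 2)|.

Lemma cube_end_continuous a d s k : continuous (@cube_end a d s k).
Proof.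
have cN y : continuous (fun x : V => `|x - y|).
  move=> x; apply: (@continuous_comp _ _ _ (fun z : V => z - y) Num.norm).
    by apply: continuousB; [exact: cvg_id|exact: cst_continuous].
  exact: norm_continuous.
move=> x; rewrite /cube_end; case: unlift => [j|]; first exact: cN.
apply: (@continuous_comp _ _ _ (fun z : V => `|z - diag (a + d * s.+1%:R / 2)|)
  (fun u : R => d * s.+1%:R / 2 - u)).
  exact: cN.
by apply: (@continuousB R R^o); [exact: cst_continuous|exact: cvg_id].
Qed.

Lemma cube_end0 a d s x : cube_end a d (ord0 : 'I_s.+1) x =
  d * s.+1%:R / 2 - `|x - diag (a + d * s.+1%:R / 2)|.
Proof. by rewrite /cube_end unlift_none. Qed.

Lemma cube_endS a d s (j : 'I_s) x :
  cube_end a d (lift ord0 j) x = `|x - diag (a + d * j.+1%:R)|.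
Proof. by rewrite /cube_end liftK. Qed.

Lemma cube_end0_gt a d s x e :
  e < cube_end a d (ord0 : 'I_s.+1) x <->
  forall i, a + e < x ord0 i < a + d * s.+1%:R - e.
Proof.
rewrite cube_end0 ltrBrDr -ltrBrDl; split=> [/rV_norm_lt|] h.
  by move=> i; have := h i; rewrite !mxE ltr_norml; lra.
by apply/rV_norm_lt => i; have := h i; rewrite !mxE ltr_norml; lra.
Qed.

Lemma cube_end0_lt a d s x e :
  cube_end a d (ord0 : 'I_s.+1) x < e <->
  exists i, d * s.+1%:R / 2 - e < `|x ord0 i - (a + d * s.+1%:R / 2)|.
Proof.
rewrite cube_end0 ltrBlDr -ltrBlDl; split=> [/rV_norm_gt|] [i].
  by rewrite !mxE => h; exists i.
by move=> h; apply/rV_norm_gt; exists i; rewrite !mxE.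
Qed.

Lemma punctured_cubeE a d s :
  punctured_cube a d s = [set x | forall k : 'I_s.+1, 0 < cube_end a d k x].
Proof.
apply/seteqP; split => x /= => [[ox nx] k|h].
  case: (unliftP ord0 k) => [j ->|->].
    by rewrite cube_endS normr_gt0 subr_eq0; apply/eqP; exact: nx.
  by apply/cube_end0_gt => i; have := ox i; lra.
split=> [i|j js xE].
  by have /cube_end0_gt/(_ i) := h ord0; lra.
have := h (lift ord0 (Ordinal js)).
by rewrite cube_endS /= xE subrr normr0 ltxx.
Qed.

Lemma punctured_cube_open a d s : open (punctured_cube a d s).
Proof.
rewrite punctured_cubeE.
rewrite openE => x Wx; 
have := @filter_forall V 'I_s.+1 (fun k => [set y | 0 < @cube_end a d s k y])
  (nbhs x).
apply => k.
have : open (cube_end a d k @^-1` [set y | 0 < y]).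
  by apply: open_comp; [move=> ? _; exact: cube_end_continuous|exact: open_gt].
by rewrite openE; apply; exact: Wx.
Qed.

Lemma punctured_cube_box a d s x e :
  (punctured_cube a d s `&` [set y | cube_end a d (ord0 : 'I_s.+1) y < e]) x <->
  punctured_cube a d s x /\
  exists i, d * s.+1%:R / 2 - e < `|x ord0 i - (a + d * s.+1%:R / 2)|.
Proof. by split=> -[? /cube_end0_lt]. Qed.

(** Triangle inequality for obstacles at distance at least [d]. As all punctures lie on the
    diagonal, one coordinate is enough to separate them. *)
Lemma hole_ball a d s j x e : 0 < d -> (j < s)%N ->
  `|x - diag (a + d * j.+1%:R)| < e -> e <= d / 2 ->
  (forall i, a + d / 2 < x ord0 i < a + d * s.+1%:R - d / 2) /\
  forall l, l != j -> d / 2 < `|x - diag (a + d * l.+1%:R)|.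
Proof.
move=> d0 js /rV_norm_lt xe ed.
have j0 : 0 <= d * j%:R by rewrite mulr_ge0// ltW.
have js' : d * j.+1%:R <= d * s%:R by rewrite ler_pM2l// ler_nat.
rewrite -natr1 in js' xe; split=> [i|l lj].
  by have := xe i; rewrite !mxE ltr_norml -[s.+1%:R]natr1; lra.
apply/rV_norm_gt; exists ord0; have := xe ord0; rewrite !mxE ltr_norml.
have [lj'|jl|/eqP] := ltngtP l j; last by rewrite (negbTE lj).
  have : d * l.+1%:R <= d * j%:R by rewrite ler_pM2l// ler_nat.
  by rewrite -[l.+1%:R]natr1 ltr_normr => ? ?; apply/orP; left; lra.
have : d * j.+1%:R <= d * l%:R by rewrite ler_pM2l// ler_nat.
by rewrite -[l.+1%:R]natr1 ltr_normr => ? ?; apply/orP; right; lra.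
Qed.

Lemma hole_ball_punctured a d s j x e : 0 < d -> (j < s)%N -> e <= d / 2 ->
  0 < `|x - diag (a + d * j.+1%:R)| < e -> punctured_cube a d s x.
Proof.
move=> d0 js ed /andP[x0 xe]; have [bx hx] := hole_ball d0 js xe ed.
split=> [i|l _ xl]; first by have := bx i; lra.
have [lj|lj] := eqVneq l j; first by rewrite xl lj subrr normr0 ltxx in x0.
by have := hx l lj; rewrite xl subrr normr0; lra.
Qed.

Lemma rim_punctured a d s x e : 0 < d -> e <= d / 2 ->
  open_cube a (d * s.+1%:R) x ->
  (exists i, d * s.+1%:R / 2 - e < `|x ord0 i - (a + d * s.+1%:R / 2)|) ->
  punctured_cube a d s x.
Proof.
move=> d0 ed ox [i xi]; split => // j js xE; move: xi; rewrite xE mxE.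
have j0 : 0 <= d * j%:R by rewrite mulr_ge0// ltW.
have js' : d * j.+1%:R <= d * s%:R by rewrite ler_pM2l// ler_nat.
rewrite -[s.+1%:R]natr1 -[j.+1%:R]natr1 ltr_normr in js' *.
by case/orP; lra.
Qed.

(** The ends are the [s] punctures and the boundary, with threshold [d / 2]. A puncture has an open
    cube minus its centre as neighbourhood, the boundary an open cube minus a concentric closed one;
    both are outer boxes. *)
Lemma punctured_cube_ends a d s : 0 < d -> has_ends s.+1 (punctured_cube a d s).
Proof.
move=> d0; rewrite punctured_cubeE; apply: (@has_ends_positivity _ _ _ _ (d / 2)).
- exact: cube_end_continuous.
- by rewrite divr_gt0.
- move=> k e e0 ed; rewrite -punctured_cubeE.
  case: (unliftP ord0 k) => [j|] ->.
    set p := a + d * j.+1%:R.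
    rewrite (_ : _ `&` _ =
      outer_box (fun=> `]p - e, p + e[%classic) (diag p) 0); last first.
      apply/seteqP; split=> x /=; rewrite cube_endS -/p => -[].
        move=> [_ nx] /rV_norm_lt xe; split.
          by move=> i; have := xe i; rewrite /= in_itv /= !mxE ltr_norml; lra.
        have /rV_norm_gt[i] : 0 < `|x - diag p|.
          by rewrite normr_gt0 subr_eq0; apply/eqP; exact: nx.
        by rewrite !mxE => ?; exists i; rewrite mxE.
      move=> bx [i xi]; have xe : `|x - diag p| < e.
        apply/rV_norm_lt => k'; have := bx k'.
        by rewrite /= in_itv /= !mxE ltr_norml; lra.
      split=> //; apply: (hole_ball_punctured d0 (ltn_ord j) ed).
      by rewrite xe andbT; apply/rV_norm_gt; exists i; rewrite !mxE in xi *.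
    apply: outer_box_connected => i; first exact: interval_is_interval.
    by exists (p + e / 2); rewrite /= ?in_itv /= ?mxE ?gtr0_norm; lra.
  set b := d * s.+1%:R.
  rewrite (_ : _ `&` _ =
    outer_box (fun=> `]a, a + b[%classic) (diag (a + b / 2)) (b / 2 - e));
    last first.
    apply/seteqP; split=> x.
      move=> /punctured_cube_box[[ox _] [i xi]]; split.
        by move=> k'; have := ox k'; rewrite /= in_itv.
      by exists i; rewrite mxE.
    move=> [bx [i]]; rewrite mxE => xi; apply/punctured_cube_box.
    split; last by exists i.
    apply: (rim_punctured d0 ed); last by exists i.
    by move=> k'; have := bx k'; rewrite /= in_itv.
  apply: outer_box_connected => i; first exact: interval_is_interval.
  have : d <= b by rewrite /b ler_peMr ?ler1n// ltW.
  by exists (a + e / 2); rewrite /= ?in_itv /= ?mxE ?ltr0_norm; lra.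
- move=> k e e0; rewrite -punctured_cubeE.
  pose r := Num.min e (d / 2).
  have r0 : 0 < r by rewrite lt_min e0 divr_gt0.
  have re : r <= e by rewrite ge_min lexx.
  have rd : r <= d / 2 by rewrite ge_min lexx orbT.
  case: (unliftP ord0 k) => [j|] ->.
    set p := a + d * j.+1%:R.
    have xr : 0 < `|diag (p + r / 2) - diag p| < r.
      apply/andP; split.
        by apply/rV_norm_gt; exists ord0; rewrite !mxE gtr0_norm; lra.
      by apply/rV_norm_lt => i; rewrite !mxE gtr0_norm; lra.
    exists (diag (p + r / 2)); split.
      exact: hole_ball_punctured d0 (ltn_ord j) rd xr.
    by rewrite /= cube_endS -/p; case/andP: xr => _ /lt_le_trans; apply.
  set b := d * s.+1%:R.
  have db : d <= b by rewrite /b ler_peMr ?ler1n// ltW.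
  exists (diag (a + r / 2)); apply/punctured_cube_box.
  have xi : exists i, b / 2 - r < `|diag (a + r / 2) ord0 i - (a + b / 2)|.
    by exists ord0; rewrite mxE ltr0_norm; lra.
  split; last by case: xi => i xi; exists i; rewrite -/b; lra.
  by apply: (rim_punctured d0 rd) => // i; rewrite mxE -/b; lra.
- move=> e e0; apply: bounded_closed_compact.
    exists (`|diag (a + d * s.+1%:R / 2)| + d * s.+1%:R / 2); split.
      exact: num_real.
    move=> M cM x /(_ ord0); rewrite cube_end0 /= => xe.
    apply: le_trans (ltW cM); rewrite -[x in `|x|](subrK (diag (a + d * s.+1%:R / 2))).
    by apply: le_trans (ler_normD _ _) _; have := e0 ord0; lra.
  rewrite (_ : mkset _ = \bigcap_k (cube_end a d k @^-1` [set y | e k <= y]));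
    last by apply/seteqP; split => x /= h k; [move=> _|]; apply: h.
  apply: closed_bigI => k _; apply: closed_comp; last exact: closed_ge.
  by move=> ? _; exact: cube_end_continuous.
- rewrite -punctured_cubeE; apply/trivIsetP => k l _ _.
  (* Up to exchanging them, either the first end is the boundary or both are punctures. *)
  wlog : k l / k = ord0 \/ exists j j', k = lift ord0 j /\ l = lift ord0 j'.
    move=> h kl; case: (unliftP ord0 k) (unliftP ord0 l) => [j kE|k0].
      case=> [j' lE|l0]; first by apply: h => //; right; exists j, j'.
      by rewrite setIC; apply: h; rewrite 1?eq_sym//; left.
    by move=> _; apply: h => //; left.
  rewrite -subset0 => -[->|[j [j' [-> ->]]]] kl x [[_ /= xk] [_ /= xl]].
    case: (unliftP ord0 l) kl xl => [j' ->|->]; last by rewrite eqxx.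
    rewrite cube_endS => _ /(hole_ball d0 (ltn_ord j'))[//|bx _].
    move: xk; rewrite ltNge => /negP; apply; apply/ltW/cube_end0_gt => i.
    exact: bx.
  rewrite !cube_endS in xk xl.
  have [_ /(_ j')] := hole_ball d0 (ltn_ord j) xk (lexx _).
  rewrite ltNge (ltW xl) => h; have /h : nat_of_ord j' != j; last by [].
  by apply: contra kl => /eqP/ord_inj ->.
Qed.

End Punctured_cubes.
(** * Chains of cubes *)

Lemma chain_connected (T : topologicalType) (A : nat -> set T) (N : nat) :
  (forall i, (i < N)%N -> connected (A i)) ->
  (forall i, (i.+1 < N)%N -> A i `&` A i.+1 !=set0) ->
  connected (\bigcup_(i < N) A i).
Proof.
elim: N => [|N IH] cA nA.
  by rewrite (_ : `I_0 = set0) ?bigcup_set0; [exact: connected0|rewrite II0].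
rewrite (_ : \bigcup_(i < N.+1) A i = (\bigcup_(i < N) A i) `|` A N); last first.
  apply/seteqP; split=> x.
    by move=> [i /=]; rewrite ltnS leq_eqVlt => /predU1P[->|iN] Ax;
      [right|left; exists i].
  by move=> [[i /= iN Ax]|Ax]; [exists i => //=; exact: ltnW|exists N => /=].
case: N => [|N] in IH cA nA *.
  by rewrite II0 bigcup_set0 set0U; exact: cA.
apply: connectedU; last exact: cA.
  have [x [x1 x2]] := nA N (ltnSn _).
  by exists x; split => //; exists N => //=.
by apply: IH => i iN; [apply: cA|apply: nA]; exact: ltnW.
Qed.

Section Cube_chains.
Context {R : realType} {n : nat}.
Notation V := 'rV[R]_n.+2.
Notation diag := (@diag R n).
Implicit Types (x p : V) (a d h : R) (s N : nat).

Lemma diag_inj : injective diag.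
Proof. by move=> a b /rowP/(_ ord0); rewrite !mxE. Qed.

(** Along coordinate 0 the cube is covered by overlapping slabs of width [2 * d], each containing
    just one puncture, at its centre. They form a chain of outer boxes. *)
Lemma punctured_cube_connected a d s : 0 < d ->
  connected (punctured_cube a d s : set V).
Proof.
move=> d0; case: s => [|s].
  rewrite (_ : punctured_cube _ _ _ = box (fun=> `]a, a + d * 1%:R[%classic)).
    by apply: box_connected => i; exact: interval_is_interval.
  apply/seteqP; split=> [x [ox _] i|x bx]; first by rewrite /= in_itv; exact: ox.
  by split => // i; have := bx i; rewrite /= in_itv.
pose I j (i : 'I_n.+2) : set R := if i == ord0
  then `]a + d * j%:R, a + d * j.+2%:R[%classic
  else `]a, a + d * s.+2%:R[%classic.
have dN j : d * j.+1%:R = d * j%:R + d by rewrite -natr1 mulrDr mulr1.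
have dM j k : (j <= k)%N -> d * j%:R <= d * k%:R.
  by move=> jk; rewrite ler_pM2l// ler_nat.
have d00 : d * 0%:R = 0 by rewrite mulr0.
rewrite (_ : punctured_cube _ _ _ =
    \bigcup_(j < s.+1) outer_box (I j) (diag (a + d * j.+1%:R)) 0).
  apply: chain_connected => j js.
    apply: outer_box_connected => i.
      by rewrite /I; case: ifP => _; exact: interval_is_interval.
    exists (a + d * j.+1%:R - d / 2).
      have := dM 0%N j isT; have := dM _ _ js.
      by rewrite /I; case: ifP => _ /=; rewrite in_itv /= !dN; lra.
    by rewrite mxE ltr0_norm; lra.
  have Ij : forall k, (k < s.+1)%N -> forall i,
      (a + d * k%:R < a + d * j%:R + d * (3 / 2) < a + d * k.+2%:R) ->
      I k i (a + d * j%:R + d * (3 / 2)).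
    move=> k ks i kj; rewrite /I; case: ifP => _ /=; rewrite in_itv //=.
    have := dM 0%N j isT; have := dM _ _ js.
    by rewrite !dN; lra.
  (* The point of the diagonal midway between punctures [j] and [j.+1]. *)
  exists (diag (a + d * j%:R + d * (3 / 2))); split; split.
  - by move=> i; rewrite mxE; apply: Ij; [exact: ltnW|rewrite !dN; lra].
  - by exists ord0; rewrite !mxE dN gtr0_norm; lra.
  - by move=> i; rewrite mxE; apply: Ij => //; rewrite !dN; lra.
  - by exists ord0; rewrite !mxE !dN ltr0_norm; lra.
apply/seteqP; split=> x.
  move=> [ox nx]; have /andP[xa xb] := ox ord0.
  (* The first slab whose right end lies beyond [x]; by minimality its left end lies before [x]. *)
  have ex : exists j, x ord0 ord0 < a + d * j.+2%:R by exists s.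
  case: (ex_minnP ex) => j xj jmin; have js : (j <= s)%N by exact: jmin.
  exists j => //; split; last first.
    have : 0 < `|x - diag (a + d * j.+1%:R)|.
      by rewrite normr_gt0 subr_eq0; apply/eqP; exact: nx.
    by move=> /rV_norm_gt[i]; rewrite !mxE => xi; exists i; rewrite mxE.
  move=> i; rewrite /I; case: eqP => [->|_] /=; rewrite in_itv /=.
    rewrite xj andbT; case: j xj jmin js => [|j] xj jmin js; first lra.
    have : ~~ (x ord0 ord0 < a + d * j.+2%:R).
      by apply/negP => /jmin; rewrite ltnn.
    by rewrite -leNgt !dN; lra.
  exact: ox.
move=> [j /= js [bx [i xi]]].
have ox : open_cube a (d * s.+2%:R) x.
  move=> k; have := bx k; rewrite /I; case: eqP => [->|_] /=; rewrite in_itv //=.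
  by have := dM 0%N j isT; have := dM _ _ js; rewrite !dN; lra.
split=> // k ks xE.
have := bx ord0; rewrite /I /= in_itv xE /= mxE.
have [kj|jk|kj] := ltngtP k j.
- by have := dM _ _ kj; rewrite !dN; lra.
- by have := dM _ _ jk; rewrite !dN; lra.
- by move: xi; rewrite xE kj !mxE subrr normr0 ltxx.
Qed.

Definition cube a h : set V := closed_cube (diag a) h.

Lemma cubeE a h x : cube a h x <-> forall i, a <= x ord0 i <= a + h.
Proof. by split=> hx i; have := hx i; rewrite !mxE. Qed.

Lemma cube_setD1_connected a h p : 0 < h -> connected (cube a h `\ p).
Proof.
move=> h0; rewrite (_ : _ `\ p = outer_box (fun=> `[a, a + h]%classic) p 0).
  apply: outer_box_connected => i; first exact: interval_is_interval.
  have [->|ap] := eqVneq (p ord0 i) a.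
    exists (a + h); first by rewrite /= in_itv /=; lra.
    by rewrite gtr0_norm; lra.
  exists a; first by rewrite /= in_itv /=; lra.
  by rewrite normr_gt0 subr_eq0 eq_sym.
apply/seteqP; split=> x.
  move=> [/cubeE qx xp]; split.
    by move=> i; have := qx i; rewrite /= in_itv.
  have /rV_norm_gt[i] : 0 < `|x - p| by rewrite normr_gt0 subr_eq0; apply/eqP.
  by rewrite !mxE => xi; exists i.
move=> [bx [i xi]]; split.
  by apply/cubeE => k; have := bx k; rewrite /= in_itv.
by move=> /= xp; move: xi; rewrite xp subrr normr0 ltxx.
Qed.

Lemma cube_connected a h : connected (cube a h).
Proof.
rewrite (_ : cube a h = box (fun=> `[a, a + h]%classic)).
  by apply: box_connected => i; exact: interval_is_interval.
by apply/seteqP; split=> x hx; [|apply/cubeE] => i; have := hx i;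
  rewrite /= in_itv // !mxE.
Qed.

Definition cube_chain a h N : set V := \bigcup_(i < N) cube (a + h * i%:R) h.

Lemma cube_corner a h (i j : nat) : 0 < h -> (i = j \/ i = j.+1) ->
  cube (a + h * j%:R) h (diag (a + h * i%:R)).
Proof.
move=> h0 ij; apply/cubeE => k; rewrite mxE.
by case: ij => ->; rewrite -?natr1 ?mulrDr; lra.
Qed.

Lemma cube_chain_connected a h N : 0 < h -> connected (cube_chain a h N).
Proof.
move=> h0; apply: chain_connected => i iN; first exact: cube_connected.
exists (diag (a + h * i.+1%:R)).
by split; apply: cube_corner => //; [right|left].
Qed.

(** Off the corner [diag c], the open set [lo] and the closed set [hi] cut the same part out of the
    chain: cubes up to [i] have all coordinates at most [c], later ones all at least [c]. This
    clopen part contains the first corner of the chain but not the last. *)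
Lemma cube_chain_cut a h N (i : nat) : 0 < h -> (i < N)%N ->
  ~ connected (cube_chain a h N.+1 `\ diag (a + h * i.+1%:R)).
Proof.
move=> h0 iN; set c := a + h * i.+1%:R => cC.
have hM j k : (j <= k)%N -> h * j%:R <= h * k%:R.
  by move=> jk; rewrite ler_pM2l// ler_nat.
have hN j : h * j.+1%:R = h * j%:R + h by rewrite -natr1 mulrDr mulr1.
pose lo : set V := \bigcup_(j : 'I_n.+2) [set x | x ord0 j < c].
pose hi : set V := \bigcap_(j : 'I_n.+2) [set x | x ord0 j <= c].
have eqc x : (forall j, x ord0 j = c) -> x = diag c.
  by move=> xc; apply/rowP => j; rewrite xc mxE.
suff E : (cube_chain a h N.+1 `\ diag c) `&` lo =
         (cube_chain a h N.+1 `\ diag c) `&` hi.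
  have : ~ lo (diag (a + h * N.+1%:R)).
    by move=> [j _] /=; rewrite mxE; have := hM _ _ iN; rewrite /c !hN; lra.
  move=> nlo; suff : ((cube_chain a h N.+1 `\ diag c) `&` lo)
    (diag (a + h * N.+1%:R)) by move=> [_ /nlo].
  rewrite (cC (_ `&` lo)).
  - split; first by exists N => //=; apply: cube_corner => //; right.
    by move=> /= /diag_inj; have := hM _ _ iN; rewrite /c !hN; lra.
  - have i0 := hM 0%N i isT.
    exists (diag a); split; last by exists ord0 => //=; rewrite mxE /c hN; lra.
    split; last by move=> /= /diag_inj; rewrite /c hN; lra.
    by exists 0%N => //; apply/cubeE => k; rewrite mxE mulr0; lra.
  - exists lo => //; apply: bigcup_open => j _.
    apply: (@open_comp _ _ (fun x : V => x ord0 j) [set y | y < c]).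
      by move=> ? _; exact: coord_continuous.
    exact: open_lt.
  - exists hi => //; apply: closed_bigI => j _.
    apply: (@closed_comp _ _ (fun x : V => x ord0 j) [set y | y <= c]).
      by move=> ? _; exact: coord_continuous.
    exact: closed_le.
apply/seteqP; split=> x [[[k /= kN /cubeE qx] xc] lx]; split => //.
- split => //; by exists k => //; apply/cubeE.
- move=> j _ /=; have [ki|ik] := leqP k i.
    by have := qx j; have := hM _ _ ki; rewrite /c hN; lra.
  by case: lx => l _ /=; have := qx l; have := hM _ _ ik; rewrite /c; lra.
- split => //; by exists k => //; apply/cubeE.
- apply: contrapT => nlo; apply: xc => /=; apply: eqc => j; apply/eqP.
  rewrite eq_le; apply/andP; split; first exact: lx.
  by rewrite leNgt; apply/negP => xj; apply: nlo; exists j.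
Qed.

(** Each cube stays connected without [p], and consecutive ones still share their common corner. *)
Lemma cube_chain_setD1_connected a h N p : 0 < h ->
  (forall i, (i < N)%N -> p <> diag (a + h * i.+1%:R)) ->
  connected (cube_chain a h N.+1 `\ p).
Proof.
move=> h0 pn; rewrite /cube_chain setD_bigcupl.
apply: chain_connected => i iN; first exact: cube_setD1_connected.
exists (diag (a + h * i.+1%:R)).
by split; (split; [apply: cube_corner => //; by [right|left]|exact/nesym/pn]).
Qed.

Lemma cube_chain_cut_points a h N : 0 < h ->
  has_cut_points N (cube_chain a h N.+1).
Proof.
move=> h0; rewrite /has_cut_points.
rewrite (_ : mkset _ = (fun i => diag (a + h * i.+1%:R)) @` `I_N).
  apply: inj_card_eq => i j _ _ /diag_inj/addrI/mulfI.
  by move=> /(_ (lt0r_neq0 h0))/eqP; rewrite eqr_nat => /eqP[].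
apply/seteqP; split=> [p [_ ncp]|_ [i /= iN <-]].
  apply: contrapT => np; apply: ncp; apply: cube_chain_setD1_connected => // i iN pE.
  by apply: np; exists i.
split; last exact: cube_chain_cut.
by exists i => /=; [exact: ltnW|apply: cube_corner => //; right].
Qed.

End Cube_chains.

(** * The family attached to a sequence of blocks *)

Section Clopen_pieces.
Context {T : topologicalType}.

Lemma connected_sub_clopen (Z C D : set T) : rel_open Z D -> rel_closed Z D ->
  C `<=` Z -> connected C -> C `&` D !=set0 -> C `<=` D.
Proof.
move=> [W oW DE] [W' cW' DE'] CZ cC CD.
suff <- : C `&` D = C by exact: subIsetr.
apply: cC => //; [exists W|exists W'] => //; [rewrite DE|rewrite DE'];
  by rewrite setIA (setIidl CZ).
Qed.

(** A clopen connected piece that meets [B k] equals it, each containing the other; otherwise it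
    lies in the connected set [Q] and equals [Q]. Only the [B k] are clopen: in (a) the closed base
    cube is not open in the union when infinitely many blocks converge to it. *)
Lemma has_clopen_piece_bigcup (J : Type) (A : set J) (Q : set T)
    (B : J -> set T) (P : set T -> Prop) (Z := Q `|` \bigcup_(k in A) B k) :
  connected Q ->
  (forall k, A k -> [/\ rel_open Z (B k), rel_closed Z (B k),
                       connected (B k) & B k `&` Q = set0]) ->
  has_clopen_piece P Z -> P Q \/ exists2 k, A k & P (B k).
Proof.
move=> cQ hB [D [oD cD [x Dx] conD PD]].
have DZ : D `<=` Z by case: oD => W _ ->; exact: subIsetl.
have QZ : Q `<=` Z by move=> z ?; left.
have BZ k : A k -> B k `<=` Z by move=> Ak z ?; right; exists k.
have DB k z : A k -> B k z -> D z -> D = B k.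
  move=> Ak Bz Dz; have [oB cB conB _] := hB k Ak.
  apply/seteqP; split; apply: (@connected_sub_clopen Z) => //;
    by [exact: BZ|exists z].
have [[k Ak [z [Dz Bz]]]|nB] :=
    pselect (exists2 k, A k & D `&` B k !=set0).
  by right; exists k => //; rewrite -(DB k z).
have DQ : D `<=` Q.
  by move=> z Dz; case: (DZ z Dz) => // -[k Ak Bz]; case: nB; exists k => //; exists z.
left; suff -> : Q = D by [].
apply/seteqP; split=> //; apply: (@connected_sub_clopen Z) => //.
by exists x; split => //; exact: DQ.
Qed.

End Clopen_pieces.

(** * Closures of punctured cubes *)

Section Construction.
Context {R : realType} {n : nat}.
Notation V := 'rV[R]_n.+2.
Notation diag := (@diag R n).
Implicit Types (x : V) (A : set nat).

Lemma closed_cube_closed (a h : R) : closed (cube a h : set V).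
Proof.
rewrite (_ : cube a h = \bigcap_(j : 'I_n.+2)
    ((fun x : V => x ord0 j) @^-1` `[a, a + h]%classic)); last first.
  apply/seteqP; split=> x.
    by move=> /cubeE hx j _; have := hx j; rewrite /= in_itv.
  by move=> hx; apply/cubeE => j; have := hx j I; rewrite /= in_itv.
apply: closed_bigI => j _; apply: closed_comp; last exact: interval_closed.
by move=> ? _; exact: coord_continuous.
Qed.

Lemma punctured_cube_sub (a d : R) (s : nat) : punctured_cube a d s `<=`
  (cube a (d * s.+1%:R) : set V).
Proof. by move=> x [ox _]; apply/cubeE => i; have := ox i; lra. Qed.

Lemma closure_punctured_cube (a d : R) (s : nat) : 0 < d ->
  closure (punctured_cube a d s) = (cube a (d * s.+1%:R) : set V).
Proof.
move=> d0; apply/seteqP; split.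
  rewrite [X in _ `<=` X](closure_id _).1; last exact: closed_cube_closed.
  exact/closureS/punctured_cube_sub.
set h := d * s.+1%:R; have h0 : 0 < h by rewrite mulr_gt0.
move=> x /cubeE qx B /nbhs_ballP[e /= e0 eB].
(* The window for coordinate [i]: inside the cube and within [e] of [x]. *)
pose lo i := Num.max a (x ord0 i - e); pose hi i := Num.min (a + h) (x ord0 i + e).
have lohi i : lo i < hi i.
  by have := qx i; rewrite /lo /hi lt_min !gt_max; lra.
pose mid i := (lo i + hi i) / 2.
(* Making two coordinates differ takes the point off the diagonal, hence away from all punctures. *)
pose u := if mid ord0 == mid ord_max then (2 * lo ord0 + hi ord0) / 3 else mid ord0.
pose z : V := \row_i if i == ord0 then u else mid i.
have zE i : lo i < z ord0 i < hi i.
  have := lohi i; rewrite mxE; case: eqP => [->|_]; last by rewrite /mid; lra.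
  by rewrite /u /mid; case: ifP => _; lra.
have uz : u != mid ord_max.
  rewrite /u; have [<-|//] := eqVneq (mid ord0) (mid ord_max).
  by have := lohi ord0; rewrite /mid; apply: contraTneq; lra.
have zx i : a < z ord0 i < a + h /\ `|x ord0 i - z ord0 i| < e.
  have := zE i; rewrite /lo /hi gt_max lt_min ltr_norml; lra.
exists z; split.
  split=> [i|j js zj]; first by have [] := zx i.
  move: uz; suff -> : u = mid ord_max by rewrite eqxx.
  have : z ord0 ord0 = z ord0 ord_max by rewrite zj !mxE.
  by rewrite !mxE.
apply: eB; rewrite -ball_normE /=; apply/rV_norm_lt => i; rewrite !mxE.
by have [_] := zx i; rewrite mxE.
Qed.

End Construction.
(** Cubes of block [k] have [k + 1] punctures at spacing [d k], hence [k + 2] steps along an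
    edge. *)
Definition edge {R : realType} (d : nat -> R) (k : nat) : R := d k * k.+2%:R.

(* The [k]-th block fills [y k, y k + (k + 2) e] on the diagonal, where
   [e = edge d k]; a collar of width [e] on either side of it is kept free of
   the other blocks and of the base cube [q, q + 1]. Away from the base cube
   the blocks are locally finite. *)
Record spread_blocks {R : realType} (y d : nat -> R) (q : R) : Prop := {
  spacing_gt0 : forall k, 0 < d k;
  blocks_apart : forall k,
    y k + edge d k * k.+3%:R <= y k.+1 - edge d k.+1;
  base_apart : forall k,
    y k + edge d k * k.+3%:R <= q \/ q + 1 <= y k - edge d k;
  blocks_locally_finite : forall t : R, ~~ (q <= t <= q + 1) ->
    exists N (r : R), 0 < r /\
      forall (k : nat) (u : R), (N <= k)%N -> `|u - t| < r ->
        ~~ (y k <= u <= y k + edge d k * k.+2%:R)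
}.

Section Family.
Context {R : realType} {n : nat} (y d : nat -> R) (q : R).
Notation V := 'rV[R]_n.+2.
Notation diag := (@diag R n).
Notation e := (edge d).
Implicit Types (x : V) (A : set nat) (k l i : nat).

Definition corner (k i : nat) : R := y k + e k * i%:R.

Definition indices A : set (nat * nat) :=
  [set ki | A ki.1 /\ (ki.2 < ki.1.+2)%N].

Definition piece (ki : nat * nat) : set V :=
  punctured_cube (corner ki.1 ki.2) (d ki.1) ki.1.+1.

Definition closed_piece (ki : nat * nat) : set V :=
  cube (corner ki.1 ki.2) (e ki.1).

Definition base : set V := punctured_cube q 1 0.

Definition open_union A : set V := base `|` \bigcup_(ki in indices A) piece ki.

Definition block k : set V := cube_chain (y k) (e k) k.+2.

(** The base cube is written as a chain of one cube, so that its lack of cut points comes from the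
    same lemma as the count for blocks. *)
Definition closed_union A : set V := cube_chain q 1 1 `|` \bigcup_(k in A) block k.

Lemma e_succ k i : e k * i.+1%:R = e k * i%:R + e k.
Proof. by rewrite -natr1 mulrDr mulr1. Qed.

Lemma base_chain : cube_chain q 1 1 = cube q 1 :> set V.
Proof.
apply/seteqP; split=> x; last by exists 0%N; rewrite //= mulr0 addr0.
by move=> [i /=]; rewrite ltnS leqn0 => /eqP ->; rewrite mulr0 addr0.
Qed.

Lemma closure_base : closure base = cube_chain q 1 1.
Proof. by rewrite closure_punctured_cube// mul1r base_chain. Qed.

Lemma base_closed : closed (cube_chain q 1 1 : set V).
Proof. by rewrite base_chain; exact: closed_cube_closed. Qed.

Lemma block_closed k : closed (block k).
Proof.
apply: closed_bigcup; first exact: finite_II.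
by move=> i _; exact: closed_cube_closed.
Qed.

Lemma closed_unionE A :
  closed_union A = cube_chain q 1 1 `|` \bigcup_(ki in indices A) closed_piece ki.
Proof.
congr (_ `|` _); apply/seteqP; split=> x.
  by move=> [k Ak [i /= ik hx]]; exists (k, i).
by move=> [[k i] [/= Ak ik] hx]; exists k => //; exists i.
Qed.

Context (hyp : spread_blocks y d q).

Let d_gt0 := spacing_gt0 hyp.
Let y_sep := blocks_apart hyp.
Let q_sep := base_apart hyp.
Let y_loc := blocks_locally_finite hyp.

Lemma e_gt0 k : 0 < e k.
Proof. by rewrite mulr_gt0. Qed.

Lemma e_mono k i j : (i <= j)%N -> e k * i%:R <= e k * j%:R.
Proof. by move=> ij; rewrite ler_pM2l ?e_gt0// ler_nat. Qed.

Lemma y_sep_lt k l : (k < l)%N -> y k + e k * k.+3%:R <= y l - e l.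
Proof.
elim: l => // l IH; rewrite ltnS leq_eqVlt => /predU1P[->//|/IH h].
have := y_sep l; have := e_gt0 l; have := e_mono l (leq0n l.+3).
by rewrite mulr0; lra.
Qed.

Lemma closure_piece ki : closure (piece ki) = closed_piece ki.
Proof. by rewrite closure_punctured_cube. Qed.

Lemma block_range k x j : block k x -> y k <= x ord0 j <= y k + e k * k.+2%:R.
Proof.
move=> [i /= ik /cubeE/(_ j)]; have := e_mono k (leq0n i); have := e_mono k ik.
by rewrite mulr0 e_succ; lra.
Qed.

(** A point off the base cube has a coordinate outside [[q, q + 1]]. By local finiteness there, only
    finitely many blocks come near the point. *)
Lemma closed_union_closed A : closed (closed_union A).
Proof.
move=> x cx; apply: contrapT => nx.
have nQ : ~ cube_chain q 1 1 x by move=> ?; apply: nx; left.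
have [j xj] : exists j, ~~ (q <= x ord0 j <= q + 1).
  apply: contrapT => /forallNP h; apply: nQ; rewrite base_chain.
  by apply/cubeE => j; apply: contrapT => /negP; exact: h.
have [N [r [r0 hN]]] := y_loc xj.
pose F := cube_chain q 1 1 `|` \bigcup_(k in A `&` `I_N) block k.
have cF : closed F.
  apply: closedU; first exact: base_closed.
  apply: closed_bigcup; last by move=> k _; exact: block_closed.
  by apply: sub_finite_set (finite_II N); exact: subIsetr.
have nF : ~ F x.
  by case=> // -[k [Ak _] bx]; apply: nx; right; exists k.
have : nbhs x (~` F `&` ball x r).
  apply: filterI; last exact: nbhsx_ballx.
  by apply: open_nbhs_nbhs; split => //; exact: closed_openC.
move=> /cx[z [Xz [nFz xz]]]; apply: nFz.
case: Xz => [Qz|[k Ak bz]]; [by left|right; exists k => //; split => //=].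
rewrite ltnNge; apply/negP => Nk.
have zx : `|z ord0 j - x ord0 j| < r.
  move: xz; rewrite -ball_normE /= => /rV_norm_lt/(_ j).
  by rewrite !mxE distrC.
by have := hN k _ Nk zx; rewrite (block_range j bz).
Qed.

Lemma closure_open_union A : closure (open_union A) = closed_union A.
Proof.
apply/seteqP; split.
  rewrite [X in _ `<=` X](closure_id _).1; last exact: closed_union_closed.
  apply: closureS; rewrite closed_unionE; apply: setUSS.
    by rewrite -closure_base; exact: subset_closure.
  by apply: subset_bigcup => ki _; rewrite -closure_piece; exact: subset_closure.
rewrite closed_unionE subUset; split.
  by rewrite -closure_base; apply: closureS; exact: subsetUl.
move=> x [ki Aki]; rewrite -closure_piece; apply: closureS => z pz.
by right; exists ki.
Qed.

Lemma open_union_open A : open (open_union A).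
Proof.
apply: openU; first exact: punctured_cube_open.
by apply: bigcup_open => ki _; exact: punctured_cube_open.
Qed.

(** The block with its two collars, seen on coordinate 0 alone: an open set that isolates block [k]
    from everything else. *)
Let strip k : set V := [set x | y k - e k < x ord0 ord0 < y k + e k * k.+3%:R].

Lemma strip_open k : open (strip k).
Proof.
apply: (@open_comp _ _ (fun x : V => x ord0 ord0)
  `]y k - e k, y k + e k * k.+3%:R[%classic); last exact: interval_open.
by move=> ? _; exact: coord_continuous.
Qed.

Lemma block_strip k x : block k x -> strip k x.
Proof.
by move=> /(@block_range _ _ ord0); rewrite /strip /= e_succ; have := e_gt0 k; lra.
Qed.

Lemma strip_block k l x : strip k x -> block l x -> l = k.
Proof.
move=> sx /(@block_range _ _ ord0) bx; move: sx; rewrite /strip /=.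
have := e_gt0 l; have := e_gt0 k.
case: (ltngtP l k) => // /y_sep_lt;
  rewrite !e_succ in bx *; move=> *; exfalso; lra.
Qed.

Lemma strip_base k x : strip k x -> ~ cube_chain q 1 1 x.
Proof.
move=> sx; rewrite base_chain => /cubeE/(_ ord0); move: sx; rewrite /strip /=.
by case: (q_sep k); lra.
Qed.

Lemma closed_union_strip A k : A k -> block k = closed_union A `&` strip k.
Proof.
move=> Ak; apply/seteqP; split=> x.
  by move=> bx; split; [right; exists k|exact: block_strip].
move=> [[bx|[l _ bl]] sx]; first by case: (strip_base sx bx).
by rewrite -(strip_block sx bl).
Qed.

(** Block [k] has [k + 2] cubes, so [k + 1] cut points; the base cube has none and cannot be
    mistaken for a block. *)
Lemma closed_union_piece A k :
  has_clopen_piece (has_cut_points k.+1) (closed_union A) <-> A k.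
Proof.
have hB A' l : A' l -> [/\ rel_open (closed_union A') (block l),
    rel_closed (closed_union A') (block l),
    connected (block l) & block l `&` cube_chain q 1 1 = set0].
  move=> Al; split.
  - by exists (strip l); [exact: strip_open|exact: closed_union_strip].
  - exists (block l); first exact: block_closed.
    by rewrite setIidr// => x bx; right; exists l.
  - exact/cube_chain_connected/e_gt0.
  - by rewrite -subset0 => x [/block_strip/strip_base].
split=> [|Ak]; last first.
  exists (block k); have [? ? ? _] := hB A k Ak; split => //.
    exists (diag (y k)), 0%N => //; apply/cubeE => i.
    by rewrite mxE mulr0; have := e_gt0 k; lra.
  exact/cube_chain_cut_points/e_gt0.
have cQ : connected (cube_chain q 1 1 : set V) by exact: cube_chain_connected.
move=> /(has_clopen_piece_bigcup cQ (hB A))[|[l Al hl]].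
  have := @cube_chain_cut_points R n q 1 0 ltr01; rewrite /has_cut_points => h0 hk.
  by have := card_eq_trans (card_esym h0) hk; move/card_eq_II.
have := @cube_chain_cut_points R n (y l) (e l) l.+1 (e_gt0 l).
rewrite /has_cut_points => h.
by have /card_eq_II[->] := card_eq_trans (card_esym hl) h.
Qed.

Lemma closed_piece_block ki : (ki.2 < ki.1.+2)%N -> closed_piece ki `<=` block ki.1.
Proof. by move=> ik x hx; exists ki.2. Qed.

(** Strips tell the blocks apart, and coordinate 0 tells apart the cubes of one block. Used both for
    relative closedness of pieces and for disjointness of interiors. *)
Lemma closed_piece_overlap ki lj x : (ki.2 < ki.1.+2)%N -> (lj.2 < lj.1.+2)%N ->
  open_cube (corner lj.1 lj.2) (e lj.1) x -> closed_piece ki x -> lj = ki.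
Proof.
case: ki lj => [k i] [l j] /= ik jl ox cx.
have lx : closed_piece (l, j) x by apply/cubeE => m /=; have := ox m; lra.
have lk : l = k.
  apply: (@strip_block _ _ x); last exact: (closed_piece_block _ lx).
  exact/block_strip/(closed_piece_block _ cx).
rewrite lk {jl lx lk} in ox *; congr pair.
move: cx => /cubeE/(_ ord0); have := ox ord0; rewrite /= /corner.
case: (ltngtP j i) => // /(e_mono k); rewrite e_succ => *; exfalso; lra.
Qed.

Lemma piece_open_cube ki x : piece ki x -> open_cube (corner ki.1 ki.2) (e ki.1) x.
Proof. by case. Qed.

Lemma base_sub : base `<=` cube_chain q 1 1.
Proof. by rewrite -closure_base; exact: subset_closure. Qed.

Lemma closed_piece_base ki x : (ki.2 < ki.1.+2)%N -> closed_piece ki x ->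
  ~ cube_chain q 1 1 x.
Proof. by move=> ik /(closed_piece_block ik)/block_strip/strip_base. Qed.

Lemma has_ends_uniq (T : topologicalType) (W : set T) (m m' : nat) :
  has_ends m W -> has_ends m' W -> m = m'.
Proof.
move=> [h nh] [h' nh'].
by have [/nh//|/nh'//|//] := ltngtP m m'.
Qed.

(** Each cube of block [k] has [k + 1] punctures, so [k + 2] ends; the base has a single end. *)
Lemma open_union_piece A k :
  has_clopen_piece (has_ends k.+2) (open_union A) <-> A k.
Proof.
have hB A' ki : indices A' ki -> [/\ rel_open (open_union A') (piece ki),
    rel_closed (open_union A') (piece ki),
    connected (piece ki) & piece ki `&` base = set0].
  move=> Aki; have [_ ik] := Aki.
  have pU : piece ki `<=` open_union A' by move=> x px; right; exists ki.
  have pc : piece ki `<=` closed_piece ki.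
    by rewrite -closure_piece; exact: subset_closure.
  split.
  - exists (piece ki); first exact: punctured_cube_open.
    by rewrite setIidr.
  (* The closed cube meets [open_union] in the piece only. *)
  - exists (closed_piece ki); first exact: closed_cube_closed.
    apply/seteqP; split=> x; first by move=> px; split; [exact: pU|exact: pc].
    move=> [[/base_sub bx|[lj [_ jl] px]] cx].
      by case: (closed_piece_base ik cx).
    by rewrite -(closed_piece_overlap ik jl (piece_open_cube px) cx).
  - exact: punctured_cube_connected.
  - by rewrite -subset0 => x [/pc/(closed_piece_base ik) nx /base_sub].
split=> [|Ak]; last first.
  have Ak0 : indices A (k, 0%N) by [].
  exists (piece (k, 0%N)); have [? ? ? _] := hB A _ Ak0; split => //.
    apply: contrapT => /nonemptyPn p0.
    have : closed_piece (k, 0%N) (diag (corner k 0)).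
      by apply/cubeE => i; rewrite mxE /=; have := e_gt0 k; lra.
    by rewrite -closure_piece p0 closure0.
  exact: punctured_cube_ends.
have cQ : connected base by exact: punctured_cube_connected.
move=> /(has_clopen_piece_bigcup cQ (hB A))[hk|[[l j] [/= Al _] hl]].
  by have := has_ends_uniq hk (punctured_cube_ends q 0 ltr01).
by have [->] := has_ends_uniq hl (punctured_cube_ends _ _ (d_gt0 l)).
Qed.

(** An interior point can be shifted by [r / 2] both ways along the diagonal without leaving the
    cube. *)
Lemma interior_cube (a h : R) : interior (cube a h) `<=` (open_cube a h : set V).
Proof.
move=> x /nbhs_ballP[r /= r0 rQ] i.
have hd t : `|t| < r -> a <= x ord0 i + t <= a + h.
  move=> tr; have /rQ/cubeE/(_ i) : ball x r (x + diag t).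
    rewrite -ball_normE /=; apply/rV_norm_lt => j.
    by rewrite !mxE opprD addNKr normrN.
  by rewrite !mxE.
have h1 : `|r / 2| < r by rewrite gtr0_norm; lra.
have h2 : `|- (r / 2)| < r by rewrite normrN.
by have := hd _ h1; have := hd _ h2; lra.
Qed.

Lemma closed_union_nonoverlapping A :
  union_of_nonoverlapping_cubes (closed_union A).
Proof.
have hQ Q : cube_chain q 1 1 = Q \/ (closed_piece @` indices A) Q ->
    is_cube Q.
  case=> [<-|[ki _ <-]].
    by exists (diag q), 1; rewrite base_chain.
  by exists (diag (corner ki.1 ki.2)), (e ki.1); split => //; exact: e_gt0.
exists [set Q | cube_chain q 1 1 = Q \/ (closed_piece @` indices A) Q]; split.
- exact: hQ.
- have hd ki : indices A ki ->
      interior (cube_chain q 1 1) `&` interior (closed_piece ki) = set0.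
    move=> [_ ik]; rewrite -subset0 => x [/interior_subset bx /interior_subset cx].
    exact: closed_piece_base ik cx bx.
  move=> Q Q' [<-|[ki Aki <-]] [<-|[lj Alj <-]] QQ' //.
  + exact: hd.
  + by rewrite setIC; exact: hd.
  + rewrite -subset0 => x [/interior_subset cx /interior_cube ox].
    apply: QQ'; congr closed_piece; apply/esym.
    by apply: closed_piece_overlap ox cx; [case: Aki|case: Alj].
- rewrite closed_unionE; apply/seteqP; split=> x.
    by move=> [bx|[ki Aki cx]]; [exists (cube_chain q 1 1) => //; left|
      exists (closed_piece ki) => //; right; exists ki].
  by move=> [Q [<-|[ki Aki <-]] Qx]; [left|right; exists ki].
Qed.

(* Only an injection of [R] into [set nat] is needed, as the family is indexed
   by [R] itself. *)
Definition lower_cut (r : R) : set nat :=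
  [set pickle p | p in [set p : rat | ratr p < r]].

Lemma lower_cut_inj : injective lower_cut.
Proof.
move=> r s; wlog rs : r s / r < s => [h E|].
  by have [/h->//|/h->//|//] := ltgtP r s.
have [p] := rat_in_itvoo rs; rewrite in_itv /= => /andP[rp ps].
move=> E; have : lower_cut s (pickle p) by exists p.
rewrite -E => -[p' /= p'r /(pcan_inj (@pickleK _)) pE].
by rewrite -pE in rp; move: (lt_trans rp p'r); rewrite ltxx.
Qed.

Definition cut_family : set (set V) := range (fun r => open_union (lower_cut r)).

Lemma cut_family_nonhomeomorphic : nonhomeomorphic_family cut_family.
Proof.
(* If [A] can be read off [U A] through topological invariants, homeomorphic values of [U] come from
   equal sets of indices. *)
have inv_inj (P : nat -> set V -> Prop) (U : set nat -> set V) :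
    (forall k, homeo_invariant (P k)) ->
    (forall A k, has_clopen_piece (P k) (U A) <-> A k) ->
    forall A B, homeomorphic_sets (U A) (U B) -> A = B.
  move=> iP hU A B /homeomorphic_homeo_pair[f [g h]].
  apply/seteqP; split=> k /hU hk; apply/hU.
    exact: has_clopen_piece_invariant h hk.
  exact: has_clopen_piece_invariant (homeo_pair_sym h) hk.
split.
- by move=> _ [r _ <-]; exact: open_union_open.
- apply: inj_card_eq => r s _ _ rs; apply: lower_cut_inj.
  apply/seteqP; split=> k /open_union_piece hk; apply/open_union_piece.
    by rewrite -rs.
  by rewrite rs.
- move=> _ _ [r _ <-] [s _ <-] UV; split=> [h|].
    apply: UV; congr open_union.
    apply: (inv_inj (fun k => has_ends k.+2)) h; last exact: open_union_piece.
    by move=> k; exact: has_ends_invariant.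
  rewrite !closure_open_union => h; apply: UV; congr open_union.
  apply: (inv_inj (fun k => has_cut_points k.+1)) h; last exact: closed_union_piece.
  by move=> k; exact: has_cut_points_invariant.
Qed.

End Family.
(** * The two placements of the blocks *)

Section Lattice_family.
Context {R : realType} {n : nat}.

(** Block [k] ends at [k * (k + 3) + k + 2], which is [k + 2] before the next block: room for two
    unit collars. The base cube [[-2, -1]] stops where the left collar of block 0 begins. *)
Let y k : R := (k * (k + 3))%:R.
Let d k : R := k.+2%:R^-1.

Let e1 k : edge d k = 1.
Proof. by rewrite /edge mulVf// pnatr_eq0. Qed.

Let lattice_spread : spread_blocks y d (- 2).
Proof.
split=> [k|k|k|t _]; first by rewrite invr_gt0.
- by rewrite !e1 mul1r lerBrDr -natrD natr1 ler_nat; lia.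
- by right; rewrite e1; have : 0 <= y k by []; lra.
(* From this index on, blocks start beyond [t + 1]. *)
exists (Num.bound `|t|).+1, 1; split => // k u Nk.
have tN : t < (Num.bound `|t|)%:R.
  by apply: le_lt_trans (ler_norm t) _; exact: archi_boundP.
have yk : (Num.bound `|t|).+1%:R <= y k by rewrite ler_nat; nia.
rewrite -natr1 in yk; rewrite ltr_norml => ut.
by apply/negP => /andP[yu _]; lra.
Qed.

Lemma lattice_family : exists F : set (set 'rV[R]_n.+2),
  nonhomeomorphic_family F /\
  (forall X, F X -> union_of_unit_lattice_cubes (closure X)).
Proof.
exists (cut_family y d (- 2)); split.
  exact: cut_family_nonhomeomorphic lattice_spread.
move=> _ [r _ <-]; rewrite (closure_open_union lattice_spread) closed_unionE.
rewrite base_chain.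
pose c (ki : nat * nat) : 'rV[int]_n.+2 :=
  const_mx (ki.1 * (ki.1 + 3) + ki.2)%:Z.
have cE ki : closed_piece y d ki = closed_cube (map_mx intr (c ki)) 1.
  rewrite /closed_piece e1 /cube map_const_mx; congr (closed_cube _ 1).
  by rewrite /diag /corner e1 mul1r -natrD.
exists [set Q | cube (- 2) 1 = Q \/
  (closed_piece y d @` indices (lower_cut r)) Q]; split.
  move=> Q [<-|[ki _ <-]]; last by exists (c ki).
  by exists (const_mx (- 2)); rewrite map_const_mx /cube; congr (closed_cube _ 1).
apply/seteqP; split=> x.
  by move=> [bx|[ki Aki cx]]; [exists (cube (- 2) 1) => //; left|
    exists (closed_piece y d ki) => //; right; exists ki].
by move=> [Q [<-|[ki Aki <-]] Qx]; [left|right; exists ki].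
Qed.

End Lattice_family.

(** * Shrinking cubes converging to a corner of the base cube, for (a) *)

Section Compact_family.
Context {R : realType} {n : nat}.

Let y k : R := - k.+1%:R^-1.
(** The distance from [y k] to [y k.+1] is [1 / ((k + 1) (k + 2))], and [edge d k] is that distance
    divided by [k + 4]. The block and its right collar take [k + 3] edges; the one left over exceeds
    the edge of the next block. *)
Let d k : R := (k.+1%:R * k.+2%:R ^+ 2 * k.+4%:R)^-1.

Let d_gt0 k : 0 < d k.
Proof. by rewrite invr_gt0 !mulr_gt0// exprn_gt0. Qed.

Let y_le0 k : y k <= 0.
Proof. by rewrite oppr_le0. Qed.

Let y_sep k : y k + edge d k * k.+3%:R <= y k.+1 - edge d k.+1.
Proof.
have natS (j : nat) : j.+1%:R = j%:R + 1 :> R by rewrite -natr1.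
rewrite /y /d /edge -subr_ge0 !natS.
have : 0 <= k%:R :> R by [].
move: (k%:R : R) => K K0.
(* The difference is [edge d k - edge d k.+1]; its numerator is
   [(K + 3) (K + 5) - (K + 1) (K + 4)]. *)
rewrite (_ : _ - _ = (3 * K + 11) /
  ((K + 1) * (K + 2) * (K + 3) * (K + 4) * (K + 5))).
  by rewrite divr_ge0 ?mulr_ge0//; lra.
by field; rewrite ?gt_eqF//; lra.
Qed.

Let block_le0 k : y k + edge d k * k.+3%:R <= 0.
Proof.
apply: le_trans (y_sep k) _; have := y_le0 k.+1.
suff : 0 < edge d k.+1 by lra.
by rewrite mulr_gt0.
Qed.

Let compact_spread : spread_blocks y d 0.
Proof.
split=> [//|//|k|t]; first by left.
have yd0 k : y k + edge d k * k.+2%:R <= 0.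
  apply: le_trans (block_le0 k); rewrite lerD2l ler_pM2l ?ler_nat//.
  by rewrite mulr_gt0.
have [t0 _|t0 /= t1] := ltP t 0.
  (* Within this radius of [t] all values stay below [t / 2], while from this index on [y k] exceeds
     [t / 2]. *)
  exists (Num.bound (- t / 2)^-1), (- t / 2); split; first lra.
  move=> k u Nk; rewrite ltr_norml => ut; apply/negP => /andP[yu _].
  have t2 : 0 < - t / 2 by lra.
  have : (- t / 2)^-1 < k.+1%:R.
    apply: lt_le_trans (archi_boundP _) _; first by rewrite invr_ge0 ltW.
    by rewrite ler_nat; exact: leqW.
  rewrite -[X in _ < X]invrK ltf_pV2 ?posrE ?invr_gt0//.
  by move: yu; rewrite /y; move: (k.+1%:R^-1) => z; lra.
(* Here [t > 1]: values within this radius exceed 1, and every block lies below 0. *)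
exists 0%N, (t - 1); split; first lra.
move=> k u _; rewrite ltr_norml => ut; apply/negP => /andP[_ uy].
by have := yd0 k; lra.
Qed.

Lemma compact_family : exists F : set (set 'rV[R]_n.+2),
  nonhomeomorphic_family F /\
  (forall X, F X ->
    compact (closure X) /\ union_of_nonoverlapping_cubes (closure X)).
Proof.
exists (cut_family y d 0); split.
  exact: cut_family_nonhomeomorphic compact_spread.
move=> _ [r _ <-]; rewrite (closure_open_union compact_spread); split; last first.
  exact: closed_union_nonoverlapping compact_spread _.
apply: bounded_closed_compact; last exact: closed_union_closed compact_spread _.
(* The blocks have coordinates in [[-1, 0]] and the base cube in [[0, 1]]. *)
exists 1; split; first exact: num_real.
move=> M M1 x Xx; apply/ltW; apply: le_lt_trans M1; apply/rV_norm_le => j.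
rewrite ler_norml; case: Xx => [|[k _ /(block_range compact_spread j)]].
  by rewrite base_chain => /cubeE/(_ j); lra.
have := block_le0 k; rewrite e_succ; suff : -1 <= y k /\ 0 < edge d k by lra.
by split; [rewrite lerN2 invf_le1// ler1n|rewrite mulr_gt0].
Qed.

End Compact_family.

Theorem theorem2 (R : realType) (n : nat) (hn : (2 <= n)%N) :
  [/\ exists F : set (set 'rV[R]_n), nonhomeomorphic_family F,
      exists F : set (set 'rV[R]_n),
        nonhomeomorphic_family F /\
        (forall X, F X ->
           compact (closure X) /\ union_of_nonoverlapping_cubes (closure X)) &
      exists F : set (set 'rV[R]_n),
        nonhomeomorphic_family F /\
        (forall X, F X -> union_of_unit_lattice_cubes (closure X))].
Proof.
case: n hn => [|[|n]]// _; split; last 2 first.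
- exact: compact_family.
- exact: lattice_family.
by have [F [hF _]] := @compact_family R n; exists F.
Qed.
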